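(* Let $N\ge 2$, let $r>0$, and consider the system $\frac{dx_i}{dt}=\sum_{j\sim i}\left[r(x_i-x_j)-(x_i-x_j)^3\right]$ on the complete graph $K_N$. Let $\mathbf{x}^\star$ be a detailed-balance stationary state with scaled state parameter $v=V/N$. Then: if $v\in(1/3,2/3)$, $\mathbf{x}^\star$ is stable; if $v\notin[1/3,2/3]$, $\mathbf{x}^\star$ is unstable.
   Context: $i\sim j$ means that nodes $i$ and $j$ are linked; in $K_N$ all pairs of distinct nodes are linked. The state space is $X=\mathbb{R}^N/\mathbf{1}$: two states are identified if they differ by a constant vector. A detailed-balance stationary state is a state $\mathbf{x}^\star$ with $x_i^\star-x_j^\star\in\{0,\pm\sqrt r\}$ for all $i\sim j$; such states are stationary. On $K_N$, every detailed-balance stationary state is, up to adding a constant, a vector having $V$ entries equal to $\sqrt r$ and $N-V$ entries equal to $0$ for some $V\in\{0,1,\dots,N\}$; its scaled state parameter is $v=V/N$. Stability is meant in the linear sense. Let $J(\mathbf{x}^\star)$ be the (symmetric) $N\times N$ Jacobian matrix of the right-hand side at $\mathbf{x}^\star$; the constant vector is always in its kernel. The state $\mathbf{x}^\star$ is stable if $J(\mathbf{x}^\star)$ is negative definite on the orthogonal complement of the constant vector, and unstable if $J(\mathbf{x}^\star)$ has at least one positive eigenvalue. *)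

(* Defs.v *)
From HB Require Import structures.
From mathcomp Require Import all_boot all_order all_algebra.
From mathcomp Require Import ring lra.
From mathcomp Require Import all_classical all_reals all_analysis.
Import Order.TTheory GRing.Theory Num.Theory.
Import numFieldNormedType.Exports.

Set Implicit Arguments.
Unset Strict Implicit.
Unset Printing Implicit Defensive.

Local Open Scope ring_scope.

Definition complete_graph (N : nat) : rel 'I_N := [rel i j | i != j].

(* States of R^N / 1 are handled through arbitrary representatives in R^N;
   see rhs_shift, detailed_balance_shift and state_parameter_shift. *)
Definition rhs (R : realType) (N : nat) (e : rel 'I_N) (r : R)
    (x : 'rV[R]_N) : 'rV[R]_N :=
  \row_i \sum_(j | e i j) (r * (x 0 i - x 0 j) - (x 0 i - x 0 j) ^+ 3).

Definition detailed_balance (R : realType) (N : nat) (e : rel 'I_N) (r : R)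
    (x : 'rV[R]_N) : Prop :=
  forall i j, e i j ->
    x 0 i - x 0 j \in [:: 0; Num.sqrt r; - Num.sqrt r].

(* This is a relation because a constant state has both V = 0 and V = N. *)
Definition state_parameter (R : realType) (N : nat) (r : R) (x : 'rV[R]_N)
    (V : nat) : Prop :=
  exists c : R, let y := x + const_mx c in
    #|[set i | y 0 i == Num.sqrt r]| = V /\
    #|[set i | y 0 i == 0]| = (N - V)%N.

(* 'J f x acts on row vectors, so its (i, j) entry is the partial derivative
   of the j-th component of f along x_i, and the left eigenvectors used by
   eigenvalue are the eigenvectors of the usual Jacobian. *)
Definition stable (R : realType) (N : nat) (f : 'rV[R]_N -> 'rV[R]_N)
    (x : 'rV[R]_N) : Prop :=
  forall u : 'rV[R]_N, u *m (const_mx 1 : 'rV[R]_N)^T = 0 -> u != 0 ->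
    (u *m 'J f x *m u^T) 0 0 < 0.

Definition unstable (R : realType) (N : nat) (f : 'rV[R]_N -> 'rV[R]_N)
    (x : 'rV[R]_N) : Prop :=
  exists2 a : R, 0 < a & eigenvalue ('J f x) a.

Lemma rhs_shift (R : realType) (N : nat) (e : rel 'I_N) (r c : R)
    (x : 'rV[R]_N) : rhs e r (x + const_mx c) = rhs e r x.
Proof.
apply/rowP => i; rewrite !mxE; apply: eq_bigr => j _.
by rewrite !mxE opprD addrACA subrr addr0.
Qed.

Lemma detailed_balance_shift (R : realType) (N : nat) (e : rel 'I_N) (r c : R)
    (x : 'rV[R]_N) :
  detailed_balance e r (x + const_mx c) <-> detailed_balance e r x.
Proof.
by split=> h i j /h; rewrite !mxE opprD addrACA subrr addr0.
Qed.

Lemma state_parameter_shift (R : realType) (N : nat) (r c : R)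
    (x : 'rV[R]_N) (V : nat) :
  state_parameter r (x + const_mx c) V <-> state_parameter r x V.
Proof.
split=> -[d hd].
  exists (c + d).
  by have <- : x + const_mx c + const_mx d = x + const_mx (c + d)
    by apply/rowP => i; rewrite !mxE addrA.
exists (d - c).
by have -> : x + const_mx c + const_mx (d - c) = x + const_mx d
  by apply/rowP => i; rewrite !mxE -addrA [c + _]addrC subrK.
Qed.

Lemma detailed_balance_stationary (R : realType) (N : nat) (e : rel 'I_N)
    (r : R) (x : 'rV[R]_N) :
  0 <= r -> detailed_balance e r x -> rhs e r x = 0.
Proof.
move=> r0 hx; apply/rowP => i; rewrite !mxE; apply: big1 => j /hx.
have s2 : Num.sqrt r ^+ 2 = r by rewrite sqr_sqrtr.
rewrite !inE => /or3P[] /eqP ->; rewrite exprS.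
- by rewrite mul0r mulr0 subrr.
- by rewrite s2 mulrC subrr.
- by rewrite sqrrN s2 mulrC subrr.
Qed.

Lemma detailed_balance_state_parameter (R : realType) (N : nat) (r : R)
    (x : 'rV[R]_N) :
  0 < r -> detailed_balance (@complete_graph N) r x ->
  exists V, state_parameter r x V.
Proof.
move=> r0 hx; set s := Num.sqrt r.
have s0 : 0 < s by rewrite sqrtr_gt0.
have h i j : [\/ x 0 i = x 0 j, x 0 i = x 0 j + s | x 0 i = x 0 j - s].
  have [->|ij] := eqVneq i j; first by constructor 1.
  have := hx i j ij; rewrite !inE => /or3P[] /eqP E.
  - by constructor 1; apply/eqP; rewrite -subr_eq0 E.
  - by constructor 2; rewrite -/s in E; rewrite -E addrC subrK.
  - by constructor 3; rewrite -/s in E; rewrite -E addrC subrK.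
have [c hc] : exists c, forall i, x 0 i = c \/ x 0 i = c + s.
  case: (pickP (@predT 'I_N)) => [i0 _|no]; last by exists 0 => i; have := no i.
  have [/existsP[j /eqP hj]|/existsPn hno] :=
    boolP [exists j, x 0 j == x 0 i0 - s].
    exists (x 0 j) => i; case: (h i j) => [->|->|hi]; [by left|by right|].
    by exfalso; case: (h i i0) => hi0; lra.
  exists (x 0 i0) => i; case: (h i i0) => [->|->|hi]; [by left|by right|].
  by move: (hno i); rewrite hi eqxx.
exists #|[set i | (x + const_mx (- c)) 0 i == s]|, (- c); split=> //=.
have -> : [set i | (x + const_mx (- c)) 0 i == 0] =
    ~: [set i | (x + const_mx (- c)) 0 i == s].
  apply/setP => i; rewrite !inE !mxE.
  case: (hc i) => ->; first by rewrite subrr eqxx eq_sym gt_eqF.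
  by rewrite addrC addKr eqxx gt_eqF.
by rewrite cardsCs finset.setCK card_ord.
Qed.

(* Main.v *)
Require Import Defs.
From HB Require Import structures.
From mathcomp Require Import all_boot all_order all_algebra.
From mathcomp Require Import ring lra zify.
From mathcomp Require Import all_classical all_reals all_analysis.
Import Order.TTheory GRing.Theory Num.Theory.
Import numFieldNormedType.Exports.

Set Implicit Arguments.
Unset Strict Implicit.
Unset Printing Implicit Defensive.

Local Open Scope ring_scope.

(** On a detailed-balance state the coupling [t |-> r t - t^3] has slope [r]
    along a link joining equal entries and [-2r] along a link joining entries
    that differ by [sqrt r]. The Jacobian is therefore a signed weighted graph
    Laplacian with only two weights.  Writing [a_i] for the 0/1 indicator of
    the upper level [A], of cardinality [V], the weight of the pair [i, j] is
    the polynomial [r (1 - 3 a_i - 3 a_j + 6 a_i a_j)]; on a complete graph the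
    sum over [j] can then be carried out, and on vectors [u] of zero sum the
    Jacobian becomes diagonal plus a rank-one term ([mulmx_jacobian_two_level]):

      (u J)_i = r (c_i u_i + 3 (1 - 2 a_i) T),   T = \sum_(j in A) u_j,

    where [c_i = 3V - 2N] on [A] and [c_i = N - 3V] off [A].

    The quadratic form is thus [r (\sum_i c_i u_i^2 - 6 T^2)]: the rank-one
    term only helps stability, and when [N < 3V < 2N] both
    values of [c_i] are negative.  Conversely, if two nodes [p] and [q] lie in
    the same level, then [e_p - e_q] has zero sum and [T = 0], so it is an
    eigenvector of eigenvalue [r c_p].  When [3V > 2N] the upper level has at
    least two nodes and [3V - 2N > 0]; when [3V < N] the same holds for the
    lower level and [N - 3V]. *)

(** * Differentials of maps into row vectors *)

Lemma is_diff_bigsum (R : realType) (U W : normedModType R) (I : finType)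
    (P : pred I) (f df : I -> U -> W) (x : U) :
  (forall i, P i -> is_diff x (f i) (df i)) ->
  is_diff x (fun y => \sum_(i | P i) f i y) (fun u => \sum_(i | P i) df i u).
Proof.
move=> fdf.
have sumE (g : I -> U -> W) :
    (fun y => \sum_(i | P i) g i y) = \sum_(i | P i) g i.
  by apply/funext => y; rewrite fct_sumE.
rewrite !sumE; apply: (big_ind2 (fun g dg => is_diff x g dg)) => //.
- exact: is_diff_cst.
- by move=> g1 dg1 g2 dg2 h1 h2; apply: is_diffD.
Qed.

Lemma is_diff_coord (R : realType) (N : nat) (x : 'rV[R]_N) (i : 'I_N) :
  is_diff x (fun y : 'rV[R]_N => y 0 i) (fun u : 'rV[R]_N => u 0 i).
Proof.
apply: DiffDef; first exact: differentiable_coord.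
have lin : linear (fun u : 'rV[R]_N => u 0 i : R^o).
  by move=> k u w; rewrite !mxE.
pose fM := GRing.isLinear.Build _ _ _ _ _ lin.
pose f : {linear 'rV[R]_N -> R^o} := HB.pack (fun u : 'rV[R]_N => u 0 i) fM.
exact: (@diff_lin _ _ _ f x (@coord_continuous _ _ _ _ _)).
Qed.

Lemma is_diff_row (R : realType) (U : normedModType R) (N : nat)
    (f df : 'I_N -> U -> R) (x : U) :
  (forall i, is_diff x (f i) (df i)) ->
  is_diff x (fun y => \row_i f i y) (fun u => \row_i df i u).
Proof.
move=> fdf.
have rowE (g : 'I_N -> U -> R) :
    (fun y => \row_i g i y) = (fun y => \sum_i g i y *: (delta_mx 0 i : 'rV_N)).
  apply/funext => y; rewrite [LHS]row_sum_delta.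
  by apply: eq_bigr => i _; rewrite mxE.
rewrite !rowE; apply: is_diff_bigsum => i _.
exact: (@is_diff_comp _ _ _ _ _ _ _ _ _ (fdf i) (is_diff_scalel _ _)).
Qed.

(** * The Jacobian as a weighted Laplacian *)

Lemma is_diff_coupling (R : realType) (N : nat) (r : R) (x : 'rV[R]_N)
    (i j : 'I_N) :
  is_diff x
    (fun y : 'rV[R]_N => r * (y 0 i - y 0 j) - (y 0 i - y 0 j) ^+ 3)
    (fun u : 'rV[R]_N =>
       (r - 3 * (x 0 i - x 0 j) ^+ 2) * (u 0 i - u 0 j)).
Proof.
have dd := @is_diffB _ _ _ _ _ _ _ _ (is_diff_coord x i) (is_diff_coord x j).
have dc := @is_diffB _ _ _ _ _ _ _ _
  (@is_diffZ _ _ _ _ _ r _ dd) (@is_diffX _ _ _ _ 2 _ dd).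
apply: (is_diff_eq dc); apply/funext => u /=.
by rewrite !fctE /= /GRing.scale /= ?fctE; ring.
Qed.

Lemma mulmx_jacobian_rhs (R : realType) (N : nat) (e : rel 'I_N) (r : R)
    (x u : 'rV[R]_N) :
  u *m 'J (rhs e r) x =
  \row_i \sum_(j | e i j)
     (r - 3 * (x 0 i - x 0 j) ^+ 2) * (u 0 i - u 0 j).
Proof.
have drhs := is_diff_row (fun i => is_diff_bigsum (P := e i)
  (fun j _ => is_diff_coupling r x i j)).
rewrite /jacobian mul_rV_lin1.
exact: (congr1 (@^~ u) (@diff_val _ _ _ _ _ _ _ drhs)).
Qed.

(** * Two-level states on the complete graph *)

(** The two levels are disjoint and their cardinalities [V] and [N - V] add up
    to [N], so that every entry lies on one of them. *)
Lemma state_parameter_two_level (R : realType) (N : nat) (r : R)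
    (x : 'rV[R]_N) (V : nat) :
  0 < r -> state_parameter r x V ->
  exists2 A : {set 'I_N}, #|A| = V &
    forall i j, x 0 i - x 0 j =
      Num.sqrt r * ((i \in A)%:R - (j \in A)%:R).
Proof.
move=> r0 [c /= []]; set s := Num.sqrt r.
have s0 : s != 0 by rewrite gt_eqF ?sqrtr_gt0.
set A := [set i | _ == s]; set B := [set i | _ == 0] => cA cB.
have BC : B = ~: A.
  apply/eqP; rewrite eqEcard; apply/andP; split.
    by apply/fintype.subsetP => i; rewrite !inE => /eqP ->; rewrite eq_sym.
  by rewrite cardsCs finset.setCK card_ord cA cB.
have xE i : x 0 i = s * (i \in A)%:R - c.
  have [iA|iA] := boolP (i \in A).
    by move: iA; rewrite inE !mxE => /eqP <-; rewrite mulr1 addrK.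
  have : i \in B by rewrite BC inE.
  by rewrite inE !mxE addr_eq0 => /eqP ->; rewrite mulr0 sub0r.
by exists A => // i j; rewrite !xE; ring.
Qed.

(** With [a_i] and [a_j] in [{0, 1}], the weight [1 - 3 (a_i - a_j)^2] equals
    [1 - 3 a_i - 3 a_j + 6 a_i a_j], which is affine in [a_j]: summing over [j]
    only involves [N], [V], the sum of [u] and its sum over [A]. *)
Lemma mulmx_jacobian_two_level (R : realType) (N : nat) (r : R)
    (x : 'rV[R]_N) (A : {set 'I_N}) (u : 'rV[R]_N) (i : 'I_N) :
  0 <= r ->
  (forall i j, x 0 i - x 0 j =
    Num.sqrt r * ((i \in A)%:R - (j \in A)%:R)) ->
  \sum_j u 0 j = 0 ->
  (u *m 'J (rhs (@complete_graph N) r) x) 0 i =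
  r * ((if i \in A then 3 * #|A|%:R - 2 * N%:R else N%:R - 3 * #|A|%:R)
         * u 0 i
       + 3 * (1 - 2 * (i \in A)%:R) * \sum_(j in A) u 0 j).
Proof.
move=> r0 xE u0; rewrite mulmx_jacobian_rhs mxE.
pose a (j : 'I_N) : R := (j \in A)%:R.
have aa j : a j ^+ 2 = a j.
  by rewrite /a; case: (j \in A); rewrite ?expr1n ?expr0n.
have sumT : \sum_(j in A) u 0 j = \sum_j a j * u 0 j.
  rewrite big_mkcond; apply: eq_bigr => j _; rewrite /a.
  by case: (j \in A); rewrite ?mul1r ?mul0r.
have sumV : #|A|%:R = \sum_j a j :> R.
  rewrite -sum1_card natr_sum big_mkcond.
  by apply: eq_bigr => j _; rewrite /a; case: (j \in A).
have sumN : N%:R = \sum_(j < N) 1 :> R by rewrite sumr_const card_ord.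
(* Adding the vanishing term [j = i] turns this into a sum over all [j]. *)
have -> : \sum_(j | complete_graph i j)
     (r - 3 * (x 0 i - x 0 j) ^+ 2) * (u 0 i - u 0 j) =
   \sum_j (r * (u 0 i - 3 * a i * u 0 i) * 1
     + r * ((6 * a i - 3) * u 0 i) * a j
     + r * (3 * a i - 1) * u 0 j
     + r * (3 - 6 * a i) * (a j * u 0 j)).
  rewrite [RHS](bigID (complete_graph i)) /= [X in _ = _ + X]big1 ?addr0.
    apply: eq_bigr => j _; rewrite xE exprMn sqr_sqrtr // -/(a i) -/(a j).
    have -> : (a i - a j) ^+ 2 = a i + a j - 2 * a i * a j.
      by rewrite sqrrB !aa; ring.
    by ring.
  move=> j; rewrite negbK => /eqP <-.
  by ring.
rewrite !big_split /= -!mulr_sumr -sumN -sumV -sumT u0 -/(a i).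
have -> : (if i \in A then 3 * #|A|%:R - 2 * N%:R else N%:R - 3 * #|A|%:R)
    = N%:R - 3 * #|A|%:R + a i * (6 * #|A|%:R - 3 * N%:R) :> R.
  by rewrite /a; case: (i \in A); rewrite ?mul1r ?mul0r; ring.
by ring.
Qed.

Lemma stable_two_level (R : realType) (N : nat) (r : R) (x : 'rV[R]_N)
    (A : {set 'I_N}) :
  0 < r ->
  (forall i j, x 0 i - x 0 j =
    Num.sqrt r * ((i \in A)%:R - (j \in A)%:R)) ->
  (N%:R : R) < 3 * #|A|%:R -> (3 * #|A|%:R : R) < 2 * N%:R ->
  stable (rhs (@complete_graph N) r) x.
Proof.
move=> r0 xE lo hi u uorth un0.
have u0 : \sum_j u 0 j = 0.
  have /(congr1 (fun M : 'M[R]_(1, 1) => M 0 0)) := uorth.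
  rewrite !mxE => {2}<-.
  by apply: eq_bigr => j _; rewrite !mxE mulr1.
pose c i : R := if i \in A then 3 * #|A|%:R - 2 * N%:R else N%:R - 3 * #|A|%:R.
have c0 i : c i < 0 by rewrite /c; case: (i \in A); lra.
set T := \sum_(j in A) u 0 j.
have -> : (u *m 'J (rhs (@complete_graph N) r) x *m u^T) 0 0 =
    r * (\sum_i c i * u 0 i ^+ 2 - 6 * T ^+ 2).
  rewrite mxE.
  have -> : T ^+ 2 = T * \sum_i (i \in A)%:R * u 0 i.
    rewrite expr2 {2}/T big_mkcond; congr (_ * _); apply: eq_bigr => i _.
    by case: (i \in A); rewrite ?mul1r ?mul0r.
  transitivity (\sum_i (r * (c i * u 0 i ^+ 2) + r * 3 * T * u 0 i
      + r * (- 6) * T * ((i \in A)%:R * u 0 i))).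
    apply: eq_bigr => i _.
    rewrite (mulmx_jacobian_two_level _ (ltW r0) xE) // -/T -/(c i) mxE.
    by ring.
  by rewrite !big_split /= -!mulr_sumr u0; ring.
rewrite pmulr_rlt0 //.
have T0 : 0 <= T ^+ 2 by exact: sqr_ge0.
suff : \sum_i c i * u 0 i ^+ 2 < 0 by lra.
have [k uk0] : exists k, u 0 k != 0.
  by apply/existsP; apply: contra_neqT un0 => /existsPn h; apply/rowP => k;
    move: (h k); rewrite negbK mxE => /eqP.
rewrite (bigD1 k) //= -[ltRHS]addr0; apply: ltr_leD.
  by rewrite nmulr_rlt0 // exprn_even_gt0.
by apply: sumr_le0 => i _; rewrite nmulr_rle0 // sqr_ge0.
Qed.

(** Moving one node up and another node of the same level down creates no
    imbalance between the levels, so only the diagonal part of the Jacobian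
    acts. *)
Lemma eigenvalue_same_level (R : realType) (N : nat) (r : R) (x : 'rV[R]_N)
    (A : {set 'I_N}) (p q : 'I_N) :
  0 <= r ->
  (forall i j, x 0 i - x 0 j =
    Num.sqrt r * ((i \in A)%:R - (j \in A)%:R)) ->
  p != q -> (p \in A) = (q \in A) ->
  eigenvalue ('J (rhs (@complete_graph N) r) x)
    (r * if p \in A then 3 * #|A|%:R - 2 * N%:R else N%:R - 3 * #|A|%:R).
Proof.
move=> r0 xE pq pqA.
pose u : 'rV[R]_N := delta_mx 0 p - delta_mx 0 q.
have uE i : u 0 i = (i == p)%:R - (i == q)%:R by rewrite !mxE.
have sum1 (P : pred 'I_N) k : \sum_(i | P i) (i == k)%:R = (P k)%:R :> R.
  rewrite big_mkcond (bigD1 k) //= eqxx big1 ?addr0; first by case: (P k).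
  by move=> i /negbTE ->; case: (P i).
have u0 : \sum_j u 0 j = 0.
  by under eq_bigr do rewrite uE; rewrite sumrB !sum1 subrr.
have uT : \sum_(j in A) u 0 j = 0.
  by under eq_bigr do rewrite uE; rewrite sumrB !sum1 pqA subrr.
apply/eigenvalueP; exists u; last first.
  apply/negP => /eqP /rowP /(_ p); rewrite uE mxE eqxx (negbTE pq) subr0.
  by apply/eqP; rewrite oner_eq0.
apply/rowP => i; rewrite (mulmx_jacobian_two_level _ r0 xE u0) uT.
rewrite mulr0 addr0 [RHS]mxE mulrA uE.
have [->|ip] := eqVneq i p; first by [].
have [->|iq] := eqVneq i q; first by rewrite pqA.
by rewrite subrr !mulr0.
Qed.

Theorem proposition7 (R : realType) (N : nat) (r : R) (x : 'rV[R]_N) (V : nat)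
    (v : R) :
  (2 <= N)%N -> 0 < r ->
  detailed_balance (@complete_graph N) r x ->
  state_parameter r x V ->
  v = V%:R / N%:R ->
  (1 / 3 < v < 2 / 3 -> stable (rhs (@complete_graph N) r) x) /\
  (~~ (1 / 3 <= v <= 2 / 3) -> unstable (rhs (@complete_graph N) r) x).
Proof.
move=> N2 r0 _ /state_parameter_two_level => /(_ r0) [A cA xE] vE.
have N0 : (0 : R) < N%:R by rewrite ltr0n; lia.
have VE : #|A|%:R = v * N%:R :> R by rewrite vE cA divfK ?gt_eqF.
split.
  by move=> /andP[lo hi]; apply: (stable_two_level r0 xE); rewrite VE; nra.
rewrite negb_and -!ltNge => /orP[lo|hi].
(* The level carrying the eigenvector has more than [2N/3 > 1] nodes. *)
- have cond : (3 * #|A|%:R : R) < N%:R by rewrite VE; nra.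
  have /card_gt1P [p [q [pB qB pq]]] : (1 < #|~: A|)%N.
    move: cond; rewrite -natrM ltr_nat => cond.
    by have := cardsC A; rewrite card_ord; lia.
  move: pB qB; rewrite !inE => /negbTE pB /negbTE qB.
  have := eigenvalue_same_level (ltW r0) xE pq (etrans pB (esym qB)).
  by rewrite pB => ev; eexists; last exact: ev; rewrite mulr_gt0 // subr_gt0.
- have cond : (2 * N%:R : R) < 3 * #|A|%:R by rewrite VE; nra.
  have /card_gt1P [p [q [pA qA pq]]] : (1 < #|A|)%N.
    by move: cond; rewrite -!natrM ltr_nat; lia.
  have := eigenvalue_same_level (ltW r0) xE pq (etrans pA (esym qA)).
  by rewrite pA => ev; eexists; last exact: ev; rewrite mulr_gt0 // subr_gt0.
Qed.
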